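(* Let $X\subset\mathbb{R}^n$ be nonempty and open, let $f_j\colon X\to\mathbb{R}$ ($j\in J:=\{1,\dots,p\}$) and $g_i\colon X\to\mathbb{R}$ ($i\in I:=\{1,\dots,m\}$) be continuously differentiable, and let $\mathcal{F}:=\{x\in X: g_i(x)\le 0,\ i\in I\}$. Consider the vector optimization problem (VP) of minimizing $f=(f_1,\dots,f_p)$ over $\mathcal{F}$ with respect to the componentwise order. Let $\bar x\in\mathcal{F}$. Suppose that $f_j$, $j\in J$, and $g_i$, $i\in I(\bar x)$, are second-order directionally differentiable at $\bar x$ in every direction $d\in T(\mathcal{F};\bar x)\cap\mathcal{C}(f;\bar x)$. Suppose that for each $d\in[T(\mathcal{F};\bar x)\cap\mathcal{C}(f;\bar x)]\setminus\{0\}$ the following two conditions hold: (I) there is $(\mu,\lambda)\in(\mathbb{R}^p_+\times\mathbb{R}^m_+)\setminus\{(0,0)\}$ such that $$\sum_{j=1}^p\mu_j\nabla f_j(\bar x)+\sum_{i=1}^m\lambda_i\nabla g_i(\bar x)=0,$$ $$\sum_{j=1}^p\mu_j f_j''(\bar x;d)+\sum_{i=1}^m\lambda_i g_i''(\bar x;d)>0,$$ $$\lambda_i g_i(\bar x)=0\quad\text{for all } i\in I;$$ (II) $$\max_{j\in J(\bar x;d)}\langle\nabla f_j(\bar x),w\rangle>0\quad\text{for all } w\in\big(\mathcal{C}(\bar x;d)\cap d^{\perp}\big)\setminus\{0\}.$$ Then $\bar x$ is a strict local efficient solution of order $2$ of (VP).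
   Context: $\langle\cdot,\cdot\rangle$ and $\|\cdot\|$ are the Euclidean scalar product and norm; $B(y,r)$ is the open ball with center $y$ and radius $r$; $\mathbb{R}^p_+$ is the nonnegative orthant; $d^{\perp}:=\{u\in\mathbb{R}^n:\langle d,u\rangle=0\}$. Second-order directional derivative (Demyanov--Pevnyi): for $\phi\colon X\to\mathbb{R}$ differentiable at $x\in X$ and $d\in\mathbb{R}^n$, $$\phi''(x;d):=\lim_{t\downarrow0}\frac{2}{t^2}\big[\phi(x+td)-\phi(x)-t\langle\nabla\phi(x),d\rangle\big];$$ $\phi$ is second-order directionally differentiable at $x$ in the direction $d$ if this limit exists and is finite. Tangent cone: $T(\mathcal{F};\bar x):=\{h\in\mathbb{R}^n:\exists\, t_k\to0^+,\ \exists\, h^k\to h,\ \bar x+t_kh^k\in\mathcal{F}\ \forall k\in\mathbb{N}\}$. Index sets and cones: $I(\bar x):=\{i\in I: g_i(\bar x)=0\}$; $J(\bar x;d):=\{j\in J:\langle\nabla f_j(\bar x),d\rangle=0\}$; $I(\bar x;d):=\{i\in I(\bar x):\langle\nabla g_i(\bar x),d\rangle=0\}$; $\mathcal{C}(f;\bar x):=\{d\in\mathbb{R}^n:\langle\nabla f_j(\bar x),d\rangle\le0,\ j\in J\}$; $\mathcal{C}(\bar x;d):=\{w\in\mathbb{R}^n:\langle\nabla g_i(\bar x),w\rangle\le0,\ i\in I(\bar x;d)\}$. Strict local efficient solution of order $2$: $\bar x\in\mathcal{F}$ is one if there exist a neighborhood $U$ of $\bar x$ and a constant $\alpha>0$ such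 that $$\big(f(x)+\mathbb{R}^p_+\big)\cap B\big(f(\bar x),\alpha\|x-\bar x\|^2\big)=\emptyset\quad\text{for all } x\in(U\cap\mathcal{F})\setminus\{\bar x\}.$$ Conventions: a term $\lambda_i g_i''(\bar x;d)$ with $\lambda_i=0$ (in particular with $i\notin I(\bar x)$) is taken to be $0$; a maximum over the empty set is $-\infty$. *)

(* Defs.v *)
From HB Require Import structures.
From mathcomp Require Import all_boot all_order all_algebra.
From mathcomp Require Import all_classical all_reals all_analysis.

Set Implicit Arguments.
Unset Strict Implicit.
Unset Printing Implicit Defensive.

Import Order.TTheory GRing.Theory Num.Theory.
Import numFieldNormedType.Exports.

Local Open Scope classical_set_scope.
Local Open Scope ring_scope.

(* Points of R^n are row vectors.  The library norm on 'rV[R]_n is the max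
   norm: it is used for the topology only, and every norm or ball that occurs
   in a quantitative condition is the Euclidean one defined here. *)
Definition dotv (R : realType) (n : nat) (u v : 'rV[R]_n) : R :=
  \sum_(i < n) u 0 i * v 0 i.

Definition enorm (R : realType) (n : nat) (u : 'rV[R]_n) : R :=
  Num.sqrt (dotv u u).

Definition eball (R : realType) (n : nat) (y : 'rV[R]_n) (r : R) :
  set 'rV[R]_n := [set z | enorm (z - y) < r].

Definition orth (R : realType) (n : nat) (d : 'rV[R]_n) : set 'rV[R]_n :=
  [set u | dotv d u = 0].

Definition orthant (R : realType) (p : nat) : set 'rV[R]_p :=
  [set y | forall j, 0 <= y 0 j].

Definition grad (R : realType) (n : nat) (phi : 'rV[R]_n -> R)
  (x : 'rV[R]_n) : 'rV[R]_n := \row_(i < n) 'D_(delta_mx 0 i) phi x.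

(* A function X -> R on an open set X is represented by a total function of
   which only the values on X matter: differentiability, the gradient and the
   limit below, at a point of X, depend only on the values near that point. *)
Definition C1_on (R : realType) (n : nat) (X : set 'rV[R]_n)
    (phi : 'rV[R]_n -> R) : Prop :=
  (forall x, X x -> differentiable phi x) /\ {within X, continuous (grad phi)}.

Definition quot2 (R : realType) (n : nat) (phi : 'rV[R]_n -> R)
    (x d : 'rV[R]_n) (t : R) : R :=
  2 / t ^+ 2 * (phi (x + t *: d) - phi x - t * dotv (grad phi x) d).

(* Convergence in R, so the limit is finite. *)
Definition ddiff2 (R : realType) (n : nat) (phi : 'rV[R]_n -> R)
    (x d : 'rV[R]_n) : Prop :=
  cvg (quot2 phi x d t @[t --> 0^'+]).

(* A default value when ddiff2 phi x d fails; products 0 * dder2 phi x d are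
   then still 0. *)
Definition dder2 (R : realType) (n : nat) (phi : 'rV[R]_n -> R)
    (x d : 'rV[R]_n) : R :=
  lim (quot2 phi x d t @[t --> 0^'+]).

Definition tangent_cone (R : realType) (n : nat) (F : set 'rV[R]_n)
    (x : 'rV[R]_n) : set 'rV[R]_n :=
  [set h | exists (t : nat -> R) (hk : nat -> 'rV[R]_n),
    [/\ forall k, 0 < t k, t k @[k --> \oo] --> (0 : R),
        hk k @[k --> \oo] --> h & forall k, F (x + t k *: hk k)]].

Definition feasible (R : realType) (n m : nat) (X : set 'rV[R]_n)
    (g : 'I_m -> 'rV[R]_n -> R) : set 'rV[R]_n :=
  [set x | X x /\ forall i, g i x <= 0].

Definition active (R : realType) (n m : nat) (g : 'I_m -> 'rV[R]_n -> R)
    (x : 'rV[R]_n) : set 'I_m := [set i | g i x = 0].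

Definition active_dir (R : realType) (n m : nat) (g : 'I_m -> 'rV[R]_n -> R)
    (x d : 'rV[R]_n) : set 'I_m :=
  [set i | active g x i /\ dotv (grad (g i) x) d = 0].

Definition obj_dir (R : realType) (n p : nat) (f : 'I_p -> 'rV[R]_n -> R)
    (x d : 'rV[R]_n) : set 'I_p := [set j | dotv (grad (f j) x) d = 0].

Definition obj_cone (R : realType) (n p : nat) (f : 'I_p -> 'rV[R]_n -> R)
    (x : 'rV[R]_n) : set 'rV[R]_n :=
  [set d | forall j, dotv (grad (f j) x) d <= 0].

Definition constr_cone (R : realType) (n m : nat) (g : 'I_m -> 'rV[R]_n -> R)
    (x d : 'rV[R]_n) : set 'rV[R]_n :=
  [set w | forall i, active_dir g x d i -> dotv (grad (g i) x) w <= 0].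

Definition vobj (R : realType) (n p : nat) (f : 'I_p -> 'rV[R]_n -> R)
    (x : 'rV[R]_n) : 'rV[R]_p := \row_(j < p) f j x.

Definition strict_local_efficient2 (R : realType) (n p : nat)
    (f : 'I_p -> 'rV[R]_n -> R) (F : set 'rV[R]_n) (xbar : 'rV[R]_n) : Prop :=
  F xbar /\
  exists (U : set 'rV[R]_n) (alpha : R),
    [/\ nbhs xbar U, 0 < alpha &
        forall x, ((U `&` F) `\ xbar) x ->
          [set vobj f x + y | y in @orthant R p]
          `&` eball (vobj f xbar) (alpha * enorm (x - xbar) ^+ 2) = set0].

(* Main.v *)
(* By contradiction, take feasible y_k -> xbar violating the estimate with
   alpha = 1/(k+1), write y_k = xbar + t_k h_k with t_k the Euclidean distance
   from y_k to xbar, let h_k -> d along an ultrafilter and put r_k = h_k - d.  To second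
   order a C1 function phi satisfies
     phi(y_k) - phi(xbar) = t_k <grad phi, h_k> + t_k^2/2 phi''(xbar; d)
                            + o(t_k (t_k + |r_k|)).
   If |r_k| <= M t_k, combining these expansions with the multipliers of (I)
   kills the first-order terms and leaves a positive multiple of t_k^2 that is
   bounded by o(t_k^2).  Otherwise |r_k| dominates t_k, and the limit w of
   r_k / |r_k| contradicts (II); it is orthogonal to d because h_k and d are
   both Euclidean unit vectors. *)
Require Import Defs.
From HB Require Import structures.
From mathcomp Require Import all_boot all_order all_algebra.
From mathcomp Require Import all_classical all_reals all_analysis.
From mathcomp Require Import ring lra.

Import Order.TTheory GRing.Theory Num.Theory.
Import numFieldNormedType.Exports.

Local Open Scope classical_set_scope.
Local Open Scope ring_scope.

Set Implicit Arguments.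
Unset Strict Implicit.

(** * Euclidean scalar product and norm, compared with the max norm *)

Lemma dotvE (R : realType) (n : nat) (u v : 'rV[R]_n) :
  dotv u v = (u *m v^T) 0 0.
Proof. by rewrite /dotv mxE; apply: eq_bigr => i _; rewrite mxE. Qed.

Lemma dotvC (R : realType) (n : nat) (u v : 'rV[R]_n) : dotv u v = dotv v u.
Proof. by apply: eq_bigr => i _; rewrite mulrC. Qed.

Lemma dotvDr (R : realType) (n : nat) (u v w : 'rV[R]_n) :
  dotv u (v + w) = dotv u v + dotv u w.
Proof. by rewrite !dotvE linearD mulmxDr mxE. Qed.

Lemma dotvZr (R : realType) (n : nat) (a : R) (u v : 'rV[R]_n) :
  dotv u (a *: v) = a * dotv u v.
Proof. by rewrite !dotvE linearZ -scalemxAr mxE. Qed.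

Lemma dotvBr (R : realType) (n : nat) (u v w : 'rV[R]_n) :
  dotv u (v - w) = dotv u v - dotv u w.
Proof. by rewrite dotvDr -scaleN1r dotvZr mulN1r. Qed.

Lemma dotv0l (R : realType) (n : nat) (u : 'rV[R]_n) : dotv 0 u = 0.
Proof. by rewrite dotvE mul0mx mxE. Qed.

Lemma dotv_suml (R : realType) (n : nat) (I : finType) (c : I -> R)
    (a : I -> 'rV[R]_n) (v : 'rV[R]_n) :
  dotv (\sum_i c i *: a i) v = \sum_i c i * dotv (a i) v.
Proof.
rewrite dotvE mulmx_suml summxE.
by apply: eq_bigr => i _; rewrite -scalemxAl mxE -dotvE.
Qed.

Lemma dotv_ge0 (R : realType) (n : nat) (u : 'rV[R]_n) : 0 <= dotv u u.
Proof. by apply: sumr_ge0 => i _; rewrite -expr2 sqr_ge0. Qed.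

Lemma dotv_eq0 (R : realType) (n : nat) (u : 'rV[R]_n) :
  (dotv u u == 0) = (u == 0).
Proof.
apply/eqP/eqP => [u0|->]; last exact: dotv0l.
apply/rowP => i; rewrite mxE; apply/eqP.
have := u0; move/eqP; rewrite psumr_eq0 => [/allP/(_ i)|j _]; last first.
  by rewrite -expr2 sqr_ge0.
by rewrite mem_index_enum mulf_eq0 orbb => /(_ isT).
Qed.

Lemma coord_le_norm (R : realType) (n : nat) (u : 'rV[R]_n) (i : 'I_n) :
  `|u 0 i| <= `|u|.
Proof.
rewrite [leRHS]mx_normrE.
exact: (le_bigmax _ (fun ij : 'I_1 * 'I_n => `|u ij.1 ij.2|) (0, i)).
Qed.

Lemma normr_dotv_le (R : realType) (n : nat) (u v : 'rV[R]_n) :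
  `|dotv u v| <= n%:R * `|u| * `|v|.
Proof.
apply: le_trans (ler_norm_sum _ _ _) _.
rewrite -mulrA mulr_natl.
have -> : `|u| * `|v| *+ n = \sum_(i < n) `|u| * `|v|.
  by rewrite sumr_const card_ord.
by apply: ler_sum => i _; rewrite normrM ler_pM ?coord_le_norm.
Qed.

Lemma enorm_sqr (R : realType) (n : nat) (u : 'rV[R]_n) :
  enorm u ^+ 2 = dotv u u.
Proof. by rewrite sqr_sqrtr ?dotv_ge0. Qed.

Lemma coord_le_enorm (R : realType) (n : nat) (u : 'rV[R]_n) (i : 'I_n) :
  `|u 0 i| <= enorm u.
Proof.
rewrite -(ler_pXn2r (isT : (0 < 2)%N)) ?nnegrE ?sqrtr_ge0// enorm_sqr.
rewrite real_normK ?num_real// /dotv (bigD1 i)//= -expr2 lerDl.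
by apply: sumr_ge0 => j _; rewrite -expr2 sqr_ge0.
Qed.

Lemma norm_le_enorm (R : realType) (n : nat) (u : 'rV[R]_n) :
  `|u| <= enorm u.
Proof.
rewrite [leLHS]mx_normrE; apply: bigmax_le => [|[i j] _] /=.
  exact: sqrtr_ge0.
by rewrite (ord1 i) coord_le_enorm.
Qed.

Lemma enorm_le_norm (R : realType) (n : nat) (u : 'rV[R]_n) :
  enorm u <= n%:R * `|u|.
Proof.
rewrite -(ler_pXn2r (isT : (0 < 2)%N)) ?nnegrE ?sqrtr_ge0 ?mulr_ge0//.
rewrite enorm_sqr (le_trans (ler_norm _))// (le_trans (normr_dotv_le _ _))//.
case: n u => [|n] u; first by rewrite !mul0r expr2 mul0r.
rewrite exprMn -mulrA -expr2 ler_wpM2r ?sqr_ge0//.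
by rewrite -natrX ler_nat expnS expn1 leq_pmulr.
Qed.

Lemma cvg_dotv (R : realType) (n : nat) (T : Type) (F : set_system T)
    {FF : Filter F} (u v : T -> 'rV[R]_n) (a b : 'rV[R]_n) :
  u k @[k --> F] --> a -> v k @[k --> F] --> b ->
  dotv (u k) (v k) @[k --> F] --> dotv a b.
Proof.
move=> ua vb; apply: cvg_big => [|i _]; first exact: add_continuous.
apply: cvgM.
  exact: (continuous_cvg _ (@coord_continuous R 1 n 0 i a) ua).
exact: (continuous_cvg _ (@coord_continuous R 1 n 0 i b) vb).
Qed.

(** * Gradients, mean values and strict differentiability *)

Lemma derive_dotv (R : realType) (n : nat) (phi : 'rV[R]_n -> R)
    (x v : 'rV[R]_n) :
  differentiable phi x -> 'D_v phi x = dotv (grad phi x) v.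
Proof.
move=> dphi; rewrite deriveE// {1}(row_sum_delta v) linear_sum.
by apply: eq_bigr => i _; rewrite linearZ /= mxE deriveE// mulrC.
Qed.

Lemma segment_mean_value (R : realType) (n : nat) (phi : 'rV[R]_n -> R)
    (u v : 'rV[R]_n) :
  (forall s, 0 <= s <= 1 -> differentiable phi (v + s *: (u - v))) ->
  exists2 c, 0 <= c <= 1 &
    phi u - phi v = dotv (grad phi (v + c *: (u - v))) (u - v).
Proof.
move=> dphi.
pose h (s : R) := phi (v + s *: (u - v)).
have dl (s : R) : is_diff s (fun s : R => v + s *: (u - v))
    (fun s : R => s *: (u - v)).
  have : is_diff s (cst v + (fun s : R => s *: (u - v)))
    (0 + (fun s : R => s *: (u - v))) by exact: is_diffD.
  by rewrite add0r.
have hd (s : R) : 0 <= s <= 1 ->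
    is_derive s 1 h (dotv (grad phi (v + s *: (u - v))) (u - v)).
  move=> s01; have dphis := dphi _ s01.
  have [dls dlE] := dl s.
  have dh : differentiable h s by exact: differentiable_comp.
  apply: DeriveDef; first exact/derivable1_diffP.
  by rewrite deriveE// diff_comp//= dlE scale1r -deriveE// derive_dotv.
have [] := @MVT_segment R h
  (fun s => dotv (grad phi (v + s *: (u - v))) (u - v)) 0 1.
- by [].
- by move=> s; rewrite in_itv/= => /andP[s0 s1]; apply: hd; rewrite !ltW.
- apply: continuous_in_subspaceT => s; rewrite inE/= in_itv/= => s01.
  have [] := hd _ s01 => hs _; apply: differentiable_continuous.
  exact/derivable1_diffP.
move=> c; rewrite in_itv/= => c01; rewrite subr0 mulr1 => hc.
by exists c => //; rewrite -hc /h scale1r scale0r addr0 [v + _]addrC subrK.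
Qed.

(** The mean value theorem on the segment from [v] to [u] gives the increment as a gradient at an
    intermediate point, which continuity of the gradient keeps close to the one at [x]. *)
Lemma strict_differentiability (R : realType) (n : nat) (X : set 'rV[R]_n)
    (phi : 'rV[R]_n -> R) (x : 'rV[R]_n) (e : R) :
  open X -> X x -> C1_on X phi -> 0 < e ->
  exists2 delta, 0 < delta & forall u v, ball x delta u -> ball x delta v ->
    `|phi u - phi v - dotv (grad phi x) (u - v)| <= e * `|u - v|.
Proof.
move=> oX Xx [dphi]; rewrite continuous_open_subspace// => cg e0.
(* A tolerance [e / (n + 1)] on gradients absorbs the factor [n] of [normr_dotv_le]; the 1 covers
   [n = 0]. *)
have n1 : 0 < n%:R + 1 :> R by rewrite ltr_wpDl.
have := cg x; rewrite inE => /(_ Xx) /cvg_ball/(_ _ (divr_gt0 e0 n1)) cgx.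
have /nbhs_ballP[d /= d0 dX] : nbhs x
    (X `&` [set z | ball (grad phi x) (e / (n%:R + 1)) (grad phi z)]).
  by apply: filterI => //; exact: open_nbhs_nbhs.
exists d => // u v bu bv.
have seg s : 0 <= s <= 1 -> ball x d (v + s *: (u - v)).
  move=> /andP[s0 s1]; move: bu bv; rewrite -!ball_normE /= => bu bv.
  rewrite (_ : x - _ = s *: (x - u) + (1 - s) *: (x - v)); last first.
    by apply/rowP => i; rewrite !mxE; ring.
  apply: le_lt_trans (ler_normD _ _) _; rewrite !normrZ (ger0_norm s0).
  rewrite ger0_norm ?subr_ge0//.
  (* Convexity of the ball: strictness is taken from the [u] term, whose weight [s] must then be
     nonzero. *)
  have [->|sn0] := eqVneq s 0; first by rewrite mul0r add0r subr0 mul1r.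
  rewrite (_ : d = s * d + (1 - s) * d); last by ring.
  by rewrite ltr_leD ?ler_wpM2l ?subr_ge0 ?(ltW bv)// ltr_pM2l// lt_def sn0.
have [|c c01 ->] := @segment_mean_value R n phi u v.
  by move=> s /seg/dX[/dphi].
have /dX[_ /=] := seg _ c01; rewrite -ball_normE /= => gc.
rewrite dotvC [X in _ - X]dotvC -dotvBr.
apply: le_trans (normr_dotv_le _ _) _.
rewrite mulrAC ler_wpM2r// distrC.
have := ltW gc; rewrite ler_pdivlMr// => /(le_trans _); apply.
by rewrite mulrC ler_wpM2l// lerDl.
Qed.

(** * Second-order expansion along a drifting direction *)

(** The increment is split at [x + t d]. From [x] to there, the second-order derivative leaves an
    error o(t^2); from there on, strict differentiability leaves o(t |r|). The rates of [t] and [r]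
    need not be related. *)
Lemma second_order_remainder (R : realType) (n : nat) (X : set 'rV[R]_n)
    (phi : 'rV[R]_n -> R) (x d : 'rV[R]_n) (T : Type) (F : set_system T)
    {FF : Filter F} (t : T -> R) (r : T -> 'rV[R]_n) :
  open X -> X x -> C1_on X phi -> ddiff2 phi x d ->
  (forall k, 0 < t k) -> t k @[k --> F] --> 0 ->
  r k @[k --> F] --> (0 : 'rV[R]_n) ->
  (phi (x + t k *: (d + r k)) - phi x - t k * dotv (grad phi x) (d + r k)
     - t k ^+ 2 / 2 * dder2 phi x d) / (t k * (t k + `|r k|))
    @[k --> F] --> 0.
Proof.
move=> oX Xx phiC1 phi2 t0 tcvg rcvg; apply/cvgr0Pnorm_lt => e e0.
have e20 : 0 < e / 2 by rewrite divr_gt0.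
have [delta delta0 hdelta] := strict_differentiability oX Xx phiC1 e20.
have ucvg : x + t k *: (d + r k) @[k --> F] --> x.
  have : x + t k *: (d + r k) @[k --> F] --> x + 0 *: (d + 0).
    by apply: cvgD (cvg_cst _) _; apply: cvgZ tcvg _; exact: cvgD (cvg_cst _) _.
  by rewrite scale0r addr0.
have vcvg : x + t k *: d @[k --> F] --> x.
  have : x + t k *: d @[k --> F] --> x + 0 *: d.
    by apply: cvgD (cvg_cst _) _; exact: cvgZ tcvg (cvg_cst _).
  by rewrite scale0r addr0.
(* Positivity of [t] gives convergence from the right, as the limit of [quot2] requires. *)
have tright : t k @[k --> F] --> 0^'+.
  by move=> P /tcvg; apply: (@filterS _ F) => k Pk; apply: Pk; exact: t0.
have qcvg : quot2 phi x d (t k) @[k --> F] --> dder2 phi x d.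
  exact: (cvg_comp _ _ tright phi2).
have /(_ FF) qball := cvg_ball qcvg e0.
have /(_ FF) uball := cvg_ball ucvg delta0.
have /(_ FF) vball := cvg_ball vcvg delta0.
apply: filterS3 vball uball qball => k bv bu.
rewrite -ball_normE/= distrC => qk.
have tk := t0 k; have rk := normr_ge0 (r k).
have trk : 0 < t k * (t k + `|r k|) by rewrite mulr_gt0// ltr_wpDr.
have := hdelta _ _ bu bv; rewrite scalerDr addrA.
rewrite (_ : x + _ + _ - _ = t k *: r k); last by rewrite addrC addKr.
rewrite normrZ (gtr0_norm tk) dotvZr => uvk.
rewrite normrM [X in _ * X]gtr0_norm ?invr_gt0// ltr_pdivrMr//.
rewrite (_ : _ - _ = phi (x + t k *: d + t k *: r k) - phi (x + t k *: d)
    - t k * dotv (grad phi x) (r k)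
    + t k ^+ 2 / 2 * (quot2 phi x d (t k) - dder2 phi x d)); last first.
  rewrite dotvDr /quot2; field; exact: lt0r_neq0.
apply: le_lt_trans (ler_normD _ _) _.
rewrite [in X in _ + X]normrM [X in _ + X * _]gtr0_norm ?divr_gt0 ?exprn_gt0//.
have : t k ^+ 2 / 2 * `|quot2 phi x d (t k) - dder2 phi x d| < t k ^+ 2 / 2 * e.
  by rewrite ltr_pM2l// divr_gt0 ?exprn_gt0.
have : 0 <= e * (t k * `|r k|).
  by apply: mulr_ge0; [exact: ltW|apply: mulr_ge0 => //; exact: ltW].
nra.
Qed.

(** * Inequalities satisfied by limit directions *)

(** Sets of a proper filter are nonempty, so for each [i] an index can be chosen where [t] and [hk]
    are both within 1/(i+1) of their limits; this recovers the sequences of the definition. *)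
Lemma tangent_coneP (R : realType) (n : nat) (F : set 'rV[R]_n)
    (x h : 'rV[R]_n) (T : Type) (G : set_system T) {FG : ProperFilter G}
    (t : T -> R) (hk : T -> 'rV[R]_n) :
  (forall k, 0 < t k) -> t k @[k --> G] --> 0 -> hk k @[k --> G] --> h ->
  (forall k, F (x + t k *: hk k)) -> tangent_cone F x h.
Proof.
move=> t0 tcvg hcvg Fx.
have /choice[s hs] (i : nat) : exists k,
    `|t k| < i.+1%:R^-1 /\ `|h - hk k| < i.+1%:R^-1.
  have i0 : 0 < i.+1%:R^-1 :> R by rewrite invr_gt0.
  apply: (@filter_ex _ G); apply: filterI.
    by have /cvgr0Pnorm_lt/(_ _ i0) := tcvg.
  by have /cvgrPdist_lt/(_ _ i0) := hcvg.
have harm0 (e : R) : 0 < e -> \forall i \near \oo, i.+1%:R^-1 < e :> R.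
  by move=> e0; exact: near_infty_natSinv_lt (PosNum e0).
exists (t \o s), (hk \o s); split => //=.
- apply/cvgr0Pnorm_lt => e /harm0; apply: filterS => i; apply: lt_trans.
  by have [] := hs i.
- apply/cvgrPdist_lt => e /harm0; apply: filterS => i; apply: lt_trans.
  by have [] := hs i.
Qed.

(** Strict differentiability gives t <grad, h> <= e t^2 + c t eventually, for any c > 0; divide by
    [t] and pass to the limit. *)
Lemma first_order_necessary (R : realType) (n : nat) (X : set 'rV[R]_n)
    (phi : 'rV[R]_n -> R) (x d : 'rV[R]_n) (T : topologicalType)
    (F : set_system T)
    {FF : ProperFilter F} (t e : T -> R) (h : T -> 'rV[R]_n) :
  open X -> X x -> C1_on X phi ->
  (forall k, 0 < t k) -> t k @[k --> F] --> 0 -> e k @[k --> F] --> 0 ->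
  h k @[k --> F] --> d ->
  (forall k, phi (x + t k *: h k) - phi x <= e k * t k ^+ 2) ->
  dotv (grad phi x) d <= 0.
Proof.
move=> oX Xx phiC1 t0 tcvg ecvg hcvg dec; apply/ler_addgt0Pr => c c0.
(* Eventually |h| <= |d| + 1, so precision c / (|d| + 1) yields an error of at most c t. *)
have d10 : 0 < `|d| + 1 by rewrite ltr_wpDl.
have [delta delta0 hdelta] :=
  strict_differentiability oX Xx phiC1 (divr_gt0 c0 d10).
have ucvg : x + t k *: h k @[k --> F] --> x.
  have : x + t k *: h k @[k --> F] --> x + 0 *: d.
    by apply: cvgD (cvg_cst _) _; exact: cvgZ tcvg _.
  by rewrite scale0r addr0.
have etc : e k * t k + c @[k --> F] --> 0 + c.
  apply: cvgD; last exact: cvg_cst.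
  by rewrite -[X in _ --> X](mulr0 0); exact: cvgM.
have gcvg : dotv (grad phi x) (h k) @[k --> F] --> dotv (grad phi x) d.
  exact: cvg_dotv (cvg_cst _) hcvg.
apply: (ler_cvg_to gcvg etc).
have uball : \forall k \near F, ball x delta (x + t k *: h k).
  exact: (cvg_ball ucvg).
have hd1 : \forall k \near F, `|h k| <= `|d| + 1.
  have /cvgrPdist_lt/(_ 1 ltr01) := hcvg; apply: filterS => k /ltW hk.
  rewrite -[h k](subrK d) (le_trans (ler_normD _ _))// addrC lerD2l//.
  by rewrite distrC.
apply: filterS2 uball hd1 => k uk hk.
have tk := t0 k.
have := hdelta _ _ uk (ballxx _ delta0).
rewrite (_ : x + _ - x = t k *: h k); last by rewrite addrC addKr.
rewrite normrZ (gtr0_norm tk) dotvZr => /ler_normlP[+ _].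
rewrite opprB => hle; have dk := dec k.
have cle : c / (`|d| + 1) * (t k * `|h k|) <= c * t k.
  rewrite mulrAC ler_pdivrMr// -mulrA ler_wpM2l ?(ltW c0)//.
  by rewrite ler_pM2l.
have : t k * dotv (grad phi x) (h k) <= t k * (e k * t k + c).
  by rewrite addrC in dk; nra.
by rewrite ler_pM2l.
Qed.

(** When |r| = O(t), the remainder o(t (t + |r|)) is o(t^2). Half of [c] absorbs it, the other half
    absorbs [e]. *)
Lemma second_order_bounded_drift (R : realType) (n : nat) (X : set 'rV[R]_n)
    (phi : 'rV[R]_n -> R) (x d : 'rV[R]_n) (T : Type) (F : set_system T)
    {FF : Filter F} (t e : T -> R) (r : T -> 'rV[R]_n) (M c : R) :
  open X -> X x -> C1_on X phi -> ddiff2 phi x d ->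
  (forall k, 0 < t k) -> t k @[k --> F] --> 0 -> e k @[k --> F] --> 0 ->
  r k @[k --> F] --> (0 : 'rV[R]_n) ->
  (forall k, phi (x + t k *: (d + r k)) - phi x <= e k * t k ^+ 2) ->
  (\forall k \near F, `|r k| <= M * t k) -> 0 < c ->
  \forall k \near F, t k * dotv (grad phi x) (d + r k)
    + t k ^+ 2 / 2 * dder2 phi x d <= c * t k ^+ 2.
Proof.
move=> oX Xx phiC1 phi2 t0 tcvg ecvg rcvg dec rM c0.
have c20 : 0 < c / 2 by rewrite divr_gt0.
have M0 : 0 < `|M| + 1 by rewrite ltr_wpDl.
have /cvgr0Pnorm_lt/(_ _ (divr_gt0 c20 M0)) rem :=
  second_order_remainder (FF := FF) oX Xx phiC1 phi2 t0 tcvg rcvg.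
have /cvgr0Pnorm_lt/(_ _ c20) ec := ecvg.
apply: filterS3 rem ec rM => k.
set N := (_ - _ - _); have tk := t0 k; have rk := normr_ge0 (r k).
have trk : 0 < t k * (t k + `|r k|) by rewrite mulr_gt0// ltr_wpDr.
rewrite normrM [X in _ * X]gtr0_norm ?invr_gt0// ltr_pdivrMr// => Nk.
move=> /ltr_normlW ek rMk.
have tMk : t k * (t k + `|r k|) <= t k ^+ 2 * (`|M| + 1).
  rewrite expr2 -mulrA ler_pM2l// mulrDr mulr1 addrC lerD2r mulrC.
  by rewrite (le_trans rMk)// ler_pM2r// ler_norm.
have : `|N| <= c / 2 * t k ^+ 2.
  apply: le_trans (ltW Nk) _; rewrite mulrAC ler_pdivrMr//.
  by rewrite -[leRHS]mulrA ler_pM2l.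
move=> /ler_normlP[+ _]; have := dec k; rewrite /N.
have : e k * t k ^+ 2 <= c / 2 * t k ^+ 2 by rewrite ler_wpM2r ?sqr_ge0 ?ltW.
lra.
Qed.

(** With <grad, d> = 0 the first-order term is t <grad, r>. After division by t |r| every other term
    tends to 0, because t / |r| does. *)
Lemma second_order_dominant_drift (R : realType) (n : nat) (X : set 'rV[R]_n)
    (phi : 'rV[R]_n -> R) (x d w : 'rV[R]_n) (T : topologicalType)
    (F : set_system T)
    {FF : ProperFilter F} (t e : T -> R) (r : T -> 'rV[R]_n) :
  open X -> X x -> C1_on X phi -> ddiff2 phi x d ->
  dotv (grad phi x) d = 0 ->
  (forall k, 0 < t k) -> t k @[k --> F] --> 0 -> e k @[k --> F] --> 0 ->
  r k @[k --> F] --> (0 : 'rV[R]_n) ->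
  (forall k, phi (x + t k *: (d + r k)) - phi x <= e k * t k ^+ 2) ->
  (\forall k \near F, r k != 0) -> t k / `|r k| @[k --> F] --> 0 ->
  `|r k|^-1 *: r k @[k --> F] --> w ->
  dotv (grad phi x) w <= 0.
Proof.
move=> oX Xx phiC1 phi2 gd0 t0 tcvg ecvg rcvg dec rn0 trcvg wcvg.
have := second_order_remainder (FF := FF) oX Xx phiC1 phi2 t0 tcvg rcvg.
set rho := (X in X @ _ --> _) => rhocvg.
(* Upper bound on <grad, r / |r|>; the factor of [rho] is t (t + |r|) / (t |r|). *)
have bcvg : (e k - dder2 phi x d / 2) * (t k / `|r k|)
    - rho k * (t k / `|r k| + 1) @[k --> F] -->
    (0 - dder2 phi x d / 2) * 0 - 0 * (0 + 1).
  apply: cvgB; apply: cvgM.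
  - exact: cvgB ecvg (cvg_cst _).
  - exact: trcvg.
  - exact: rhocvg.
  - exact: cvgD trcvg (cvg_cst _).
rewrite mulr0 mul0r subr0 in bcvg.
have gcvg : dotv (grad phi x) (`|r k|^-1 *: r k) @[k --> F] -->
    dotv (grad phi x) w.
  exact: cvg_dotv (cvg_cst _) wcvg.
apply: (ler_cvg_to gcvg bcvg).
apply: filterS rn0 => k rk0.
have tk := t0 k; have rk : 0 < `|r k| by rewrite normr_gt0.
rewrite dotvZr.
have rhoE : rho k * (t k * (t k + `|r k|)) =
    phi (x + t k *: (d + r k)) - phi x - t k * dotv (grad phi x) (d + r k)
     - t k ^+ 2 / 2 * dder2 phi x d.
  by rewrite /rho divfK// lt0r_neq0// mulr_gt0// addr_gt0.
rewrite dotvDr gd0 add0r in rhoE.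
have := dec k; move: rhoE; set D := _ - phi x => rhoE Dle.
rewrite -(ler_pM2l (mulr_gt0 tk rk)).
rewrite (_ : t k * `|r k| * (_^-1 * _) = t k * dotv (grad phi x) (r k));
  last by field; exact: lt0r_neq0.
rewrite (_ : t k * `|r k| * _ = e k * t k ^+ 2 - t k ^+ 2 / 2 * dder2 phi x d
   - rho k * (t k * (t k + `|r k|))); last by field; exact: lt0r_neq0.
lra.
Qed.

(** * Compactness, and the negation of strict efficiency *)

Lemma ultrafilter_cvg_bounded (R : realType) (n : nat) (T : Type)
    (G : set_system T) {UG : UltraFilter G} (u : T -> 'rV[R]_n) :
  (forall k, `|u k| <= 1) -> exists l : 'rV[R]_n, u k @[k --> G] --> l.
Proof.
move=> u1.
have compact1 : compact [set v : 'rV[R]_n | `|v| <= 1].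
  apply: bounded_closed_compact.
    exists 1; split; first exact: num_real.
    by move=> M M1 v /= v1; rewrite (le_trans v1)// ltW.
  rewrite (_ : mkset _ = @closed_ball _ 'rV[R]_n 0 1).
    exact: closed_ball_closed.
  rewrite closed_ballE//; apply/seteqP.
  by split => v /=; rewrite /closed_ball_/= sub0r normrN.
have [|l [_ ul]] := compact1 (u k @[k --> G]) _.
  by apply: (@filterE _ G) => k; exact: u1.
exists l => B lB.
(* If the preimage of a neighborhood [B] of the cluster point were not in [G], its complement would
   be, and would have to meet [B]. *)
have [//|GB] := in_ultra_setVsetC (u @^-1` B) UG.
have [z [/= nBz Bz]] := ul (~` B) B GB lB.
by [].
Qed.

Lemma not_strict_local_efficient2 (R : realType) (n p : nat)
    (f : 'I_p -> 'rV[R]_n -> R) (F : set 'rV[R]_n) (x : 'rV[R]_n) :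
  F x -> ~ strict_local_efficient2 f F x ->
  exists y : nat -> 'rV[R]_n, forall k,
    [/\ F (y k), y k != x, `|y k - x| < k.+1%:R^-1 &
        forall j, f j (y k) - f j x <= k.+1%:R^-1 * enorm (y k - x) ^+ 2].
Proof.
move=> Fx nstrict.
suff /choice[y hy] : forall k : nat, exists y,
    [/\ F y, y != x, `|y - x| < k.+1%:R^-1 &
        forall j, f j y - f j x <= k.+1%:R^-1 * enorm (y - x) ^+ 2] by exists y.
move=> k; apply: contrapT => /forallNP noy; apply: nstrict; split=> //.
have k0 : 0 < k.+1%:R^-1 :> R by rewrite invr_gt0.
(* Without such a [y], this ball and this constant would witness strict efficiency. *)
exists (ball x k.+1%:R^-1), k.+1%:R^-1; split => //; first exact: nbhsx_ballx.
move=> y [[+ Fy] /eqP yx]; rewrite -ball_normE/= distrC => xy.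
apply/seteqP; split => // z [[v /= v0 <-] vball]; apply: (noy y).
split => // j.
(* As v >= 0, f_j(y) - f_j(x) <= (f(y) + v - f(x))_j, which is at most the Euclidean norm. *)
apply: le_trans (ltW vball); apply: le_trans (coord_le_enorm _ j).
by rewrite !mxE (le_trans _ (ler_norm _))// addrAC lerDl.
Qed.

(** The value [-oo] of an empty maximum is not positive, so some index exists. *)
Lemma bigmaxe_gt0 (R : realType) (I : finType) (P : pred I) (a : I -> R) :
  (0 < \big[maxe/-oo]_(i | P i) (a i)%:E)%E -> exists2 i, P i & 0 < a i.
Proof.
move=> a0; apply: contrapT => noi; move: a0; apply/negP; rewrite -leNgt.
apply: bigmax_le => [|i Pi]; first exact: leNye.
rewrite lee_fin leNgt; apply/negP => ai0; apply: noi; by exists i.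
Qed.

(** * Second-order sufficiency, by contradiction *)

Unset Implicit Arguments.

Theorem theorem2p1 (R : realType) (n p m : nat) (X : set 'rV[R]_n)
    (f : 'I_p -> 'rV[R]_n -> R) (g : 'I_m -> 'rV[R]_n -> R)
    (xbar : 'rV[R]_n)
    (X_nonempty : X !=set0) (X_open : open X)
    (f_C1 : forall j, C1_on X (f j)) (g_C1 : forall i, C1_on X (g i))
    (xbar_feasible : feasible X g xbar)
    (f_ddiff2 : forall d,
      (tangent_cone (feasible X g) xbar `&` obj_cone f xbar) d ->
      forall j, ddiff2 (f j) xbar d)
    (g_ddiff2 : forall d,
      (tangent_cone (feasible X g) xbar `&` obj_cone f xbar) d ->
      forall i, active g xbar i -> ddiff2 (g i) xbar d)
    (cond_I : forall d,
      ((tangent_cone (feasible X g) xbar `&` obj_cone f xbar) `\ 0) d ->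
      exists (mu : 'rV[R]_p) (lam : 'rV[R]_m),
        [/\ orthant mu /\ orthant lam,
            (mu, lam) <> (0, 0),
            \sum_(j < p) mu 0 j *: grad (f j) xbar
              + \sum_(i < m) lam 0 i *: grad (g i) xbar = 0,
            0 < \sum_(j < p) mu 0 j * dder2 (f j) xbar d
                + \sum_(i < m) lam 0 i * dder2 (g i) xbar d &
            forall i, lam 0 i * g i xbar = 0])
    (cond_II : forall d,
      ((tangent_cone (feasible X g) xbar `&` obj_cone f xbar) `\ 0) d ->
      forall w, ((constr_cone g xbar d `&` orth d) `\ 0) w ->
        (0%E < \big[maxe/-oo%E]_(j < p | j \in obj_dir f xbar d)
                 (dotv (grad (f j) xbar) w)%:E)%E) :
  strict_local_efficient2 f (feasible X g) xbar.
Proof.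
apply: contrapT => nstrict.
have [y hy] := not_strict_local_efficient2 xbar_feasible nstrict.
pose e k : R := k.+1%:R^-1.
pose t k := enorm (y k - xbar); pose h k := (t k)^-1 *: (y k - xbar).
have t0 k : 0 < t k.
  have [_ yx _ _] := hy k.
  by rewrite sqrtr_gt0 lt_def dotv_ge0 dotv_eq0 subr_eq0 yx.
have yE k : xbar + t k *: h k = y k.
  by rewrite scalerA divff ?lt0r_neq0// scale1r addrC subrK.
have hh k : dotv (h k) (h k) = 1.
  rewrite dotvZr dotvC dotvZr -enorm_sqr -/(t k) mulrA -expr2 -exprMn.
  by rewrite mulVf ?expr1n// lt0r_neq0.
have h1 k : `|h k| <= 1.
  by rewrite (le_trans (norm_le_enorm _))// /enorm hh sqrtr1.
have Xxbar : X xbar by case: xbar_feasible.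
(* One ultrafilter finer than [\oo] replaces the successive extractions of subsequences, for [h] and
   later for the normalized [r]. *)
have [G [UG ooG]] := ultraFilterLemma (eventually_filter).
have eG : e k @[k --> G] --> 0.
  apply/cvgr0Pnorm_lt => c c0; apply: ooG.
  have := near_infty_natSinv_lt (PosNum c0); apply: filterS => k /=.
  by rewrite ger0_norm// invr_ge0.
have tG : t k @[k --> G] --> 0.
  (* [y k] is within [e k] of [xbar] in the max norm only; the Euclidean distance costs a factor
     [n]. *)
  have neG : n%:R * e k @[k --> G] --> 0.
    by rewrite -[X in _ --> X](mulr0 n%:R); exact: cvgM (cvg_cst _) eG.
  apply/cvgr0Pnorm_lt => c c0; have /cvgr0Pnorm_lt/(_ _ c0) := neG.
  apply: filterS => k; apply: le_lt_trans.
  rewrite (gtr0_norm (t0 k)) (le_trans _ (ler_norm _))//.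
  rewrite (le_trans (enorm_le_norm _))// ler_wpM2l//.
  by have [_ _ /ltW + _] := hy k.
have [d hd] := ultrafilter_cvg_bounded h1.
have dd1 : dotv d d = 1.
  have hhG : dotv (h k) (h k) @[k --> G] --> dotv d d by exact: cvg_dotv.
  rewrite (_ : (fun _ => _) = cst 1) in hhG; last exact/funext.
  exact: (cvg_unique (@Rhausdorff R) hhG (cvg_cst _)).
have fy j k : f j (xbar + t k *: h k) - f j xbar <= e k * t k ^+ 2.
  by rewrite yE; have [_ _ _] := hy k; exact.
have gy i k : active g xbar i ->
    g i (xbar + t k *: h k) - g i xbar <= e k * t k ^+ 2.
  (* An active [g i] vanishes at [xbar] and is nonpositive at [y k]. *)
  move=> ->; rewrite yE subr0; have [[_ /(_ i)] gy _ _ _] := hy k.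
  by rewrite (le_trans gy)// mulr_ge0 ?sqr_ge0// invr_ge0.
have critd : (tangent_cone (feasible X g) xbar `&` obj_cone f xbar) d.
  split.
    by apply: (tangent_coneP t0 tG hd) => // k; rewrite yE; have [] := hy k.
  move=> j.
  exact: (first_order_necessary X_open Xxbar (f_C1 j) t0 tG eG hd (fy j)).
have d0 : d <> 0.
  by move=> d0; move: dd1; rewrite d0 dotv0l => /esym/eqP; rewrite oner_eq0.
pose r k := h k - d.
have hE k : h k = d + r k by rewrite addrC subrK.
have rG : r k @[k --> G] --> (0 : 'rV[R]_n) by apply/subr_cvg0.
have f2 := f_ddiff2 _ critd; have g2 := g_ddiff2 _ critd.
have fr j k : f j (xbar + t k *: (d + r k)) - f j xbar <= e k * t k ^+ 2.
  by rewrite -hE.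
have gr i k : active g xbar i ->
    g i (xbar + t k *: (d + r k)) - g i xbar <= e k * t k ^+ 2.
  by rewrite -hE; exact: gy.
have [[M rM]|unbounded] := pselect
    (exists M, \forall k \near G, `|r k| <= M * t k).
  have [mu [lam [[mu0 lam0] _ stat S0 comp]]] := cond_I _ (conj critd d0).
  set S := (X in 0 < X) in S0.
  pose C := \sum_(j < p) mu 0 j + \sum_(i < m) lam 0 i.
  have C0 : 0 <= C by rewrite addr_ge0// sumr_ge0.
  (* Chosen so that c C < S / 2, against the bound S / 2 <= c C derived below; C + 1 is positive
     even if C = 0. *)
  pose c := S / (4 * (C + 1)).
  have c0 : 0 < c by rewrite divr_gt0// mulr_gt0// ltr_wpDl.
  have fc : \forall k \near G, forall j, t k * dotv (grad (f j) xbar) (d + r k)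
      + t k ^+ 2 / 2 * dder2 (f j) xbar d <= c * t k ^+ 2.
    apply: filter_forall => j.
    exact: (second_order_bounded_drift X_open Xxbar (f_C1 j) (f2 j)
      t0 tG eG rG (fr j) rM).
  have gc : \forall k \near G, forall i, active g xbar i ->
      t k * dotv (grad (g i) xbar) (d + r k)
      + t k ^+ 2 / 2 * dder2 (g i) xbar d <= c * t k ^+ 2.
    apply: filter_forall => i; have [gi0|gi] := pselect (active g xbar i).
      apply: filterS (second_order_bounded_drift X_open Xxbar (g_C1 i)
        (g2 i gi0) t0 tG eG rG (gr i ^~ gi0) rM c0) => k gik _.
      exact: gik.
    by apply: filterE => k /gi.
  have [k [fk gk]] := filter_ex (filterI fc gc).
  have stat' : \sum_(j < p) mu 0 j * dotv (grad (f j) xbar) (d + r k)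
      + \sum_(i < m) lam 0 i * dotv (grad (g i) xbar) (d + r k) = 0.
    by rewrite -!dotv_suml dotvC [X in _ + X]dotvC -dotvDr stat dotvC dotv0l.
  have sumle : t k ^+ 2 / 2 * S <= c * t k ^+ 2 * C.
    (* The zero is replaced by the stationarity sum, so that each multiplier meets the whole left
       side of its inequality in [fk] or [gk]. *)
    rewrite [leLHS](_ : _ = t k * 0 + t k ^+ 2 / 2 * S); last first.
      by rewrite mulr0 add0r.
    rewrite -stat' /S /C !mulrDr addrACA !mulr_sumr -!big_split/=.
    apply: lerD; apply: ler_sum => i _.
      rewrite [leRHS]mulrC (_ : _ + _ = mu 0 i *
        (t k * dotv (grad (f i) xbar) (d + r k)
          + t k ^+ 2 / 2 * dder2 (f i) xbar d)); last by ring.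
      by rewrite ler_wpM2l.
    rewrite [leRHS]mulrC (_ : _ + _ = lam 0 i *
        (t k * dotv (grad (g i) xbar) (d + r k)
          + t k ^+ 2 / 2 * dder2 (g i) xbar d)); last by ring.
    (* Complementarity: either the multiplier is 0, and any default value of [dder2] is harmless, or
       the constraint is active. *)
    have /eqP := comp i; rewrite mulf_eq0 => /orP[/eqP->|/eqP gi0].
      by rewrite !mul0r.
    by rewrite ler_wpM2l// gk.
  have tk2 : 0 < t k ^+ 2 by rewrite exprn_gt0.
  have : S / 2 <= c * C by rewrite -(ler_pM2l tk2); lra.
  have : c * (4 * (C + 1)) = S.
    by rewrite /c divfK// lt0r_neq0// mulr_gt0// ltr_wpDl.
  by have := mulr_ge0 (ltW c0) C0; lra.
(* For an ultrafilter, failure of |r| <= M t on a set of [G] means that the reverse holds on one,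
   for every [M]. *)
have big M : \forall k \near G, M * t k < `|r k|.
  have [GM|] := in_ultra_setVsetC [set k | `|r k| <= M * t k] UG.
    by exfalso; apply: unbounded; exists M.
  by apply: filterS => k /= /negP; rewrite -ltNge.
have rn0 : \forall k \near G, r k != 0.
  by apply: filterS (big 0) => k; rewrite mul0r normr_gt0.
have trG : t k / `|r k| @[k --> G] --> 0.
  apply/cvgr0Pnorm_lt => c c0; apply: filterS2 (big c^-1) rn0 => k.
  rewrite -normr_gt0 => bk rk; rewrite gtr0_norm ?divr_gt0// ltr_pdivrMr//.
  by rewrite mulrC -ltr_pdivrMr// mulrC.
have w1 k : `| `|r k|^-1 *: r k | <= 1.
  rewrite normrZ normfV normr_id.
  by have [->|rk] := eqVneq (r k) 0; rewrite ?normr0 ?mulr0// mulVf// normr_eq0.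
have [w wG] := ultrafilter_cvg_bounded w1.
(* The normalized [r] has max norm 1 eventually, so its limit is nonzero. *)
have w0 : w <> 0.
  move=> w0; rewrite w0 in wG; have /cvgr0Pnorm_lt/(_ _ ltr01) := wG.
  move=> wl; have [k [rk]] := filter_ex (filterI rn0 wl).
  by rewrite normrZ normfV normr_id mulVf ?normr_eq0// ltxx.
(* |d| = |d + r_k| = 1 gives <d, r_k> = - <r_k, r_k> / 2 = o(|r_k|). *)
have dw : dotv d w = 0.
  have dwG : dotv d (`|r k|^-1 *: r k) @[k --> G] --> dotv d w.
    exact: cvg_dotv (cvg_cst _) wG.
  apply: (cvg_unique _ dwG); first exact: Rhausdorff.
  have : - 2^-1 * dotv (r k) (`|r k|^-1 *: r k) @[k --> G] -->
      - 2^-1 * dotv 0 w.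
    by apply: cvgM; [exact: cvg_cst|exact: cvg_dotv].
  rewrite dotv0l mulr0; apply: cvg_trans; apply: near_eq_cvg.
  apply: filterE => k; rewrite !dotvZr mulrCA; congr (_ * _).
  have := hh k; rewrite hE dotvDr dotvC dotvDr dd1 [dotv (d + _) _]dotvC dotvDr.
  by rewrite [dotv (r k) d]dotvC; lra.
have /bigmaxe_gt0[j] : (0%E < \big[maxe/-oo%E]_(j < p | j \in obj_dir f xbar d)
    (dotv (grad (f j) xbar) w)%:E)%E.
  (* The dominant-drift inequality for the constraints in [active_dir] places [w] in
     [constr_cone]. *)
  apply: cond_II => //; split => //; split => // i [gi0 gd0].
  exact: (second_order_dominant_drift X_open Xxbar (g_C1 i) (g2 i gi0) gd0
    t0 tG eG rG (gr i ^~ gi0) rn0 trG wG).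
(* The same inequality for the objective [f j] contradicts the positive value from (II). *)
rewrite inE => fd0; apply/negP; rewrite -leNgt.
exact: (second_order_dominant_drift X_open Xxbar (f_C1 j) (f2 j) fd0
  t0 tG eG rG (fr j) rn0 trG wG).
Qed.
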